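(* Let $W=\frac{1}{\sqrt n}\sum_{i=1}^n\xi_i$ with $\xi_1,\ldots,\xi_n$ independent centered random variables with support in $\{-1,1\}$, and let $Z\sim\mathcal{N}(0,1)$. Put $\mathcal{D}f(x)=f(x+1)-f(x-1)$ and $\tau_i(\xi_i)=\mathbb{I}(\xi_i=1)$. Then each $\tau_i(\xi_i)$ is a $\mathcal{D}$-Stein kernel for $\xi_i$, $i=1,\ldots,n$, and $$d_{\mathrm{Wass}}(W,Z)\le\frac{3}{\sqrt n}.$$
   Context: $d_{\mathrm{Wass}}(W,Z)=\sup_h|\mathbb{E}h(W)-\mathbb{E}h(Z)|$, the supremum being over all $1$-Lipschitz $h:\mathbb{R}\to\mathbb{R}$. $\mathbb{I}(\cdot)$ is the indicator function. For a linear operator $\mathcal{D}$ with an associated skew-adjoint operator $\mathcal{D}^{\star}$ and shift $l$, a random variable $\tau(X)$, measurable with respect to $X$, is a $\mathcal{D}$-Stein kernel for a random variable $X$ of mean $\nu$ if $\mathbb{E}[\tau(X)\,(\mathcal{D}^{\star}g)(X-l)]=\mathbb{E}[(X-\nu)g(X)]$ for all test functions $g$. Here one takes $\mathcal{D}^{\star}=\mathcal{D}$ and $l=1$, so that the requirement for $\xi_i$ is $\mathbb{E}[\tau_i(\xi_i)(g(\xi_i)-g(\xi_i-2))]=\mathbb{E}[\xi_i g(\xi_i)]$ for all $g:\mathbb{Z}\to\mathbb{R}$. *)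

(* Defs.v *)
From HB Require Import structures.
From mathcomp Require Import all_boot all_order all_algebra.
From mathcomp Require Import all_classical all_reals all_analysis.

Set Implicit Arguments.
Unset Strict Implicit.
Unset Printing Implicit Defensive.

Import Order.TTheory GRing.Theory Num.Theory.
Import numFieldNormedType.Exports.

Local Open Scope classical_set_scope.
Local Open Scope ring_scope.

(* Mutual independence: the product rule is required on every subfamily J. *)
Definition independent_RVs d (T : measurableType d) (R : realType)
    (P : probability T R) (I : finType) (X : I -> {RV P >-> R}) : Prop :=
  forall (J : {set I}) (B : I -> set R),
    (forall i, i \in J -> measurable (B i)) ->
    P (\bigcap_(i in [set` J]) (X i @^-1` B i)) =
    (\prod_(i in J) P (X i @^-1` B i))%E.

Arguments independent_RVs {d T R} P {I} X.

(* [W] and [Z] may live on different probability spaces. *)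
Definition dWass d (T : measurableType d) d' (T' : measurableType d')
    (R : realType) (P : probability T R) (Q : probability T' R)
    (W : T -> R) (Z : T' -> R) : \bar R :=
  ereal_sup [set `| 'E_P[h \o W] - 'E_Q[h \o Z] |%E |
             h in [set h : R -> R | 1.-lipschitz h]].

(* [tau] stands for the random variable tau(X) on the sample space; its
   measurability with respect to X is expressed through sigma(X).
   The operator D enters the definition only through its skew-adjoint [Dstar]
   and the shift [l]. The integrability clauses say that both expectations
   exist as real numbers, so that the identity is not one between the default
   values of divergent integrals. *)
Definition stein_kernel d (T : measurableType d) (R : realType)
    (P : probability T R) (Dstar : (R -> R) -> (R -> R)) (l : R)
    (test : set (R -> R)) (X : {RV P >-> R}) (nu : R) (tau : T -> R) : Prop :=
  [/\ ('E_P[X] = nu%:E)%E,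
      preimage_set_system setT tau measurable `<=`
        preimage_set_system setT X measurable
    & forall g : R -> R, test g ->
      [/\ P.-integrable setT (EFin \o (fun w => tau w * Dstar g (X w - l))),
          P.-integrable setT (EFin \o (fun w => (X w - nu) * g (X w)))
        & ('E_P[fun w => (tau w * Dstar g (X w - l))%R] =
           'E_P[fun w => ((X w - nu) * g (X w))%R])%E]].

Arguments stein_kernel {d T R} P Dstar l test X nu tau.

Definition central_diff (R : realType) (f : R -> R) : R -> R :=
  fun x => f (x + 1) - f (x - 1).

(* A function g on the integers is extended to the real line as
   x |-> g (floor x); [central_diff] commutes with this extension, and for an
   integer-valued X only the values of g on the integers matter. *)
Definition lattice_fun (R : realType) : set (R -> R) :=
  [set g | exists g0 : int -> R, g = fun x => g0 (Num.floor x)].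

(* Main.v *)
Require Import Defs.
From HB Require Import structures.
From mathcomp Require Import all_boot all_order all_algebra.
From mathcomp Require Import all_classical all_reals all_analysis.
From mathcomp Require Import measurable_realfun ring lra.

Set Implicit Arguments.
Unset Strict Implicit.
Unset Printing Implicit Defensive.

Import Order.TTheory GRing.Theory Num.Theory.
Import numFieldNormedType.Exports.

Local Open Scope classical_set_scope.
Local Open Scope ring_scope.

(** The proof is Stein's method for the normal law.  Fix a 1-Lipschitz [h] and
    let [phi] be the standard normal density and [c] the integral of [h phi],
    which is the expectation of [h Z] ([expectation_normal]).  The function
    [f = Q / phi], where [Q x] is the integral of [(h - c) phi] over
    [`]-oo, x]], solves Stein's equation [f' x - x f x = h x - c], so that the
    quantity to bound is the expectation of [f' W - W f W].

    Regularity of [f] ([stein_equation_lipschitz]).  All that is needed is that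
    [f'] is 2-Lipschitz, and as [f' x = x f x + h x - c] it suffices that
    [x f x] is 1-Lipschitz.  The slope of [x f x] is
    [(1 + x ^ 2) f x + x (h x - c)], which is linear in [h] and is
    nonpositive as soon as [h] is nondecreasing ([stein_slope_le0]).  For
    [h x = x] the solution is [f = -1], with slope [-1].  Both [x + h x] and
    [x - h x] are nondecreasing, and comparing [h] with the identity in this
    way gives a slope in [[-1, 1]], without ever differentiating [h].

    The sum [W].  A centred variable with values in [{-1, 1}] is a fair sign
    ([rademacher_half]), so by independence expectations of functions of [W]
    are averages over all sign vectors ([rademacher_sum_expectation]).
    Writing [delta = n ^ (-1/2)], one has
    [f' W - W f W = \sum_i delta (delta f' W - xi_i f W)].
    Averaging the i-th term over the two values of [xi_i] gives, up to the
    factor [delta / 2], the error of the trapezoid rule for [f'] on an interval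
    of length [2 delta] whose end points are the two values of [W].  This is
    where the Stein kernel [I(xi_i = 1)] acts: it turns [xi_i f W] into a
    difference of [f].  The trapezoid error is at most [4 delta ^ 2] for a
    2-Lipschitz [f'], so each term contributes at most [2 delta ^ 3], and the
    sum of the [n] terms is at most [2 delta <= 3 delta]
    ([sign_average_stein]). *)

(** * The standard normal density *)

Section GaussianDensity.
Context {R : realType}.
Implicit Types x t : R.
Local Notation mu := (@lebesgue_measure R).
Local Notation phi := (normal_pdf (0 : R) 1).

Let phiE x : phi x = normal_peak 1 * expR (- (x ^+ 2 / 2)).
Proof.
by rewrite normal_pdfE ?oner_neq0//= /normal_fun subr0 expr1n mulNr.
Qed.

Lemma phi_gt0 x : 0 < phi x.
Proof. by rewrite phiE mulr_gt0 ?expR_gt0// normal_peak_gt0 ?oner_neq0. Qed.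

Lemma phiN x : phi (- x) = phi x.
Proof. by rewrite !phiE sqrrN. Qed.

Lemma phi_continuous : continuous phi.
Proof. by apply: continuous_normal_pdf; rewrite oner_neq0. Qed.

Lemma phi_mass : (\int[mu]_x phi x = 1)%R.
Proof. by rewrite /Rintegral integral_normal_pdf. Qed.

Lemma phi_integrable : mu.-integrable setT (EFin \o phi).
Proof. exact: integrable_normal_pdf. Qed.

Lemma is_derive_phi x : is_derive x 1 phi (- (x * phi x)).
Proof.
have -> : phi = (fun t => normal_peak 1 * expR (- (t ^+ 2 / 2))).
  by apply/funext => t; exact: phiE.
by apply: is_derive_eq; rewrite /GRing.scale/=; field.
Qed.

(** Follows from [1 + y <= expR y]; this polynomial decay is what excludes a
    positive value in [stein_slope_nonneg]. *)
Lemma phi_decay x : phi x * (1 + x ^+ 2 / 2) <= normal_peak 1.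
Proof.
rewrite phiE -mulrA ler_piMr ?normal_peak_ge0//.
rewrite expRN mulrC ler_pdivrMr ?expR_gt0// mul1r.
exact: expR_ge1Dx.
Qed.

Lemma phi_cvg0 : phi x @[x --> +oo] --> 0.
Proof.
have -> : phi = (fun t => normal_peak 1 * expR (- (t ^+ 2 * 2^-1))).
  by apply/funext => t; exact: phiE.
rewrite -[X in _ --> X](mulr0 (normal_peak (1 : R))); apply: cvgMr.
apply: (cvg_comp (fun x => x ^+ 2 * 2^-1) (fun x => expR (- x)));
  last exact: cvgr_expR.
by apply: gt0_cvgMly; [rewrite invr_gt0|exact: cvgr_expr2].
Qed.

End GaussianDensity.

(** * Regularity of the solution of Stein's equation *)

Section SteinSolution.
Context {R : realType}.
Implicit Types (x t c : R) (u Q h f df : R -> R).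
Local Notation phi := (normal_pdf (0 : R) 1).

Lemma is_derive_MVT f df (a b : R) : (forall x, is_derive x (1 : R) f (df x)) ->
  a <= b -> exists2 x, x \in `[a, b] & f b - f a = df x * (b - a).
Proof.
move=> fdf ab; apply: MVT_segment => // x.
apply: continuous_subspaceT => y.
apply: differentiable_continuous; apply/derivable1_diffP.
by have [] := fdf y.
Qed.

(** Where [u x <= c] both terms are nonpositive.  Otherwise put [k = u x - c]
    and compare [Q] on [[x, +oo[] with the function
    [- k phi t t / (1 + t ^ 2)], the classical lower bound for the Gaussian
    tail: their difference [G] is nondecreasing there, and it is bounded above
    by a function that tends to 0 because [Q <= 0].  Hence [G x <= 0], which is
    the claim. *)
Let stein_slope_nonneg u Q c : {homo u : x y / x <= y} ->
  (forall x, is_derive x (1 : R) Q ((u x - c) * phi x)) ->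
  (forall x, Q x <= 0) ->
  forall x, 0 <= x -> (1 + x ^+ 2) * Q x + x * (u x - c) * phi x <= 0.
Proof.
move=> u_nd dQ Q_le0 x x_ge0.
have sq_gt0 t : 0 < 1 + t ^+ 2 by rewrite ltr_wpDr ?sqr_ge0.
have [uxc|cux] := leP (u x) c.
  rewrite -[leRHS]addr0; apply: lerD; first by rewrite pmulr_rle0.
  by rewrite pmulr_lle0 ?phi_gt0// mulr_ge0_le0// subr_le0.
pose k := u x - c.
have k_gt0 : 0 < k by rewrite subr_gt0.
pose G t := Q t + k * (t / (1 + t ^+ 2)) * phi t.
pose dG t := (u t - c) * phi t
  + k * ((1 - t ^+ 2) / (1 + t ^+ 2) ^+ 2 - t ^+ 2 / (1 + t ^+ 2)) * phi t.
have dGE t : is_derive t (1 : R) G (dG t).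
  have ? := dQ t; have ? := is_derive_phi t.
  have ? : 1 + t ^+ 2 != 0 by rewrite gt_eqF.
  by apply: is_derive_eq; rewrite /dG /GRing.scale/=; field.
have dG_ge0 t : x <= t -> 0 <= dG t.
  move=> xt; have kt : k <= u t - c by rewrite lerD2r; exact: u_nd.
  rewrite /dG -mulrDl mulr_ge0 ?normal_pdf_ge0//.
  apply: le_trans (lerD kt (lexx _)).
  have -> : k + k * ((1 - t ^+ 2) / (1 + t ^+ 2) ^+ 2 - t ^+ 2 / (1 + t ^+ 2))
      = k * 2 / (1 + t ^+ 2) ^+ 2.
    by field; rewrite gt_eqF.
  by rewrite divr_ge0 ?sqr_ge0// mulr_ge0// ltW.
have G_nd t : x <= t -> G x <= G t.
  move=> xt; rewrite -subr_ge0.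
  have [y /itvP yxt ->] := is_derive_MVT dGE xt.
  by rewrite mulr_ge0 ?subr_ge0// dG_ge0 ?yxt.
have Gx_le0 : G x <= 0.
  rewrite leNgt; apply/negP => Gx_gt0.
  pose p := normal_peak (1 : R).
  (* [G x * t <= 2 k p] for all [t >= x], and this [t] is past that bound. *)
  pose t := x + 1 + k * (2 * p) / G x.
  have kpG_ge0 : 0 <= k * (2 * p) / G x.
    by rewrite divr_ge0 ?(ltW Gx_gt0)// !mulr_ge0 ?normal_peak_ge0// ltW.
  have t_gt0 : 0 < t by rewrite ltr_wpDr// ltr_wpDl.
  have xt : x <= t by rewrite /t -addrA lerDl addr_ge0.
  have Gxt : G x * t <= k * (2 * p).
    apply: (@le_trans _ _ (k * (t * phi t) * t)).
      rewrite ler_wpM2r ?(ltW t_gt0)//; apply: (le_trans (G_nd t xt)).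
      rewrite /G -[leRHS]add0r lerD// -mulrA ler_wpM2l ?(ltW k_gt0)//.
      rewrite ler_wpM2r ?normal_pdf_ge0// ler_pdivrMr//.
      by rewrite mulrDr mulr1 lerDl mulr_ge0 ?sqr_ge0// ltW.
    rewrite -mulrA ler_wpM2l ?(ltW k_gt0)//.
    apply: le_trans (ler_wpM2l (ler0n R 2) (phi_decay t)).
    by have := phi_gt0 t; nra.
  move: Gxt; rewrite leNgt => /negP; apply.
  rewrite /t mulrDr (mulrC (G x) (k * _ / _)) divfK ?gt_eqF// ltrDr mulr_gt0//.
  by rewrite ltr_wpDl.
have : (1 + x ^+ 2) * G x <= 0 by rewrite pmulr_rle0.
by apply: le_trans; rewrite le_eqVlt; apply/orP; left; apply/eqP;
  rewrite /G /k; field; rewrite gt_eqF.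
Qed.

(** The case [x < 0] is the case [0 < -x] for the reflected data
    [t |-> - u (- t)] and [t |-> Q (- t)]. *)
Let stein_slope_le0 u Q c : {homo u : x y / x <= y} ->
  (forall x, is_derive x (1 : R) Q ((u x - c) * phi x)) ->
  (forall x, Q x <= 0) ->
  forall x, (1 + x ^+ 2) * Q x + x * (u x - c) * phi x <= 0.
Proof.
move=> u_nd dQ Q_le0 x; have [x_ge0|x_lt0] := leP 0 x.
  exact: stein_slope_nonneg.
have dQN t : is_derive t (1 : R) (Q \o -%R) ((- u (- t) - - c) * phi t).
  have ? := dQ (- t).
  by apply: is_derive_eq; rewrite phiN; ring.
have := @stein_slope_nonneg (fun t => - u (- t)) _ (- c) _ dQN _ (- x) _.
rewrite /= opprK sqrrN phiN => /(_ _ _ _)/wrap[].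
- by move=> y z yz; rewrite lerN2 u_nd// lerN2.
- by move=> y; exact: Q_le0.
- by rewrite oppr_ge0 ltW.
- by congr (_ <= _); ring.
Qed.

(** The bound [|Q| <= phi] makes [Q - phi] and [- Q - phi] nonpositive.  These
    are the functions that [stein_slope_le0] needs for [u = h + id] and
    [u = id - h], because [- phi] is the antiderivative of [t phi t]. *)
Lemma stein_solution_regular h Q c :
  (forall x y, `|h x - h y| <= `|x - y|) ->
  (forall x, is_derive x (1 : R) Q ((h x - c) * phi x)) ->
  (forall x, `|Q x| <= phi x) ->
  let f x := Q x / phi x in
  let df x := x * f x + (h x - c) in
  (forall x, is_derive x (1 : R) f (df x)) /\
  (forall x y, `|df x - df y| <= 2 * `|x - y|).
Proof.
move=> h_lip dQ Q_le f df.
have fdf x : is_derive x (1 : R) f (df x).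
  have ? := dQ x; have ? := is_derive_phi x.
  have phi_neq0 : phi x != 0 by rewrite gt_eqF ?phi_gt0.
  by apply: is_derive_eq; rewrite /df /f /GRing.scale/=; field.
split=> // x y.
pose v t := (1 + t ^+ 2) * f t + t * (h t - c).
have dv t : is_derive t (1 : R) (fun s => s * f s) (v t).
  have ? := fdf t.
  by apply: is_derive_eq; rewrite /v /df /GRing.scale/=; ring.
have dphiQ t : is_derive t (1 : R) (fun s => Q s - phi s) ((h t + t - c) * phi t).
  have ? := dQ t; have ? := is_derive_phi t.
  by apply: is_derive_eq; ring.
have dphiNQ t : is_derive t (1 : R) (fun s => - Q s - phi s)
    ((t - h t - - c) * phi t).
  have ? := dQ t; have ? := is_derive_phi t.
  by apply: is_derive_eq; ring.
have v_le1 t : `|v t| <= 1.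
  have vE : (1 + t ^+ 2) * Q t + t * (h t - c) * phi t = v t * phi t.
    by rewrite /v /f; field; rewrite gt_eqF ?phi_gt0.
  rewrite -(ler_pM2r (phi_gt0 t)) mul1r.
  rewrite -[X in `|_| * X]ger0_norm ?normal_pdf_ge0// -normrM -vE ler_norml.
  apply/andP; split.
    have := @stein_slope_le0 (fun s => s - h s) _ (- c) _ dphiNQ _ t.
    move=> /(_ _ _)/wrap[].
    - move=> a b ab; have := h_lip a b.
      by rewrite (ler0_norm (_ : a - b <= 0)) ?subr_le0// ler_norml; lra.
    - by move=> s; have := Q_le s; rewrite ler_norml; lra.
    - by lra.
  have := @stein_slope_le0 (fun s => h s + s) _ c _ dphiQ _ t.
  move=> /(_ _ _)/wrap[].
  - move=> a b ab; have := h_lip a b.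
    by rewrite (ler0_norm (_ : a - b <= 0)) ?subr_le0// ler_norml; lra.
  - by move=> s; have := Q_le s; rewrite ler_norml; lra.
  - by lra.
wlog xy : x y / y <= x.
  by move=> H; have [/H//|/ltW/H] := leP y x; rewrite distrC (distrC x).
have [z _ zE] := is_derive_MVT dv xy.
have -> : df x - df y = (x * f x - y * f y) + (h x - h y) by rewrite /df; ring.
rewrite zE mulr_natl mulr2n; apply: (le_trans (ler_normD _ _)); apply: lerD => //.
by rewrite normrM ler_piMl.
Qed.

End SteinSolution.

(** * Gaussian integrals and existence of the solution *)

Section GaussianIntegrals.
Context {R : realType}.
Implicit Types (x t c : R) (g h u : R -> R).
Local Notation mu := (@lebesgue_measure R).
Local Notation phi := (normal_pdf (0 : R) 1).

Lemma integral_halfline_phi :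
  (\int[mu]_(t in `[0%R, +oo[) (t * phi t)%:E = (phi 0)%:E)%E.
Proof.
have dphi t : is_derive t (1 : R) (fun s => - phi s) (t * phi t).
  by have ? := is_derive_phi t; apply: is_derive_eq; rewrite opprK.
rewrite (@ge0_continuous_FTC2y _ _ (fun t => - phi t) 0 0).
- by rewrite EFinN oppeK add0e.
- by move=> x x_ge0; rewrite mulr_ge0 ?normal_pdf_ge0.
- by apply: continuous_subspaceT => x; apply: cvgM => //; exact: phi_continuous.
- by rewrite -[X in _ --> X]oppr0; apply: cvgN; exact: phi_cvg0.
- by move=> x _; have [] := dphi x.
- by apply: cvg_at_right_filter; apply: cvgN; exact: phi_continuous.
- by move=> x _; rewrite derive1E; have [_ ->] := dphi x.
Qed.

Lemma mul_phi_integrable : mu.-integrable setT (EFin \o (fun t => t * phi t)).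
Proof.
apply/integrableP; split.
  apply/measurable_EFinP; apply: measurable_funM => //.
  exact: measurable_normal_pdf.
rewrite /= ge0_symfun_integralT.
- rewrite -set_itvcy [X in (_ * X)%E](_ : _ = (phi 0)%:E) ?ltry//.
  rewrite -integral_halfline_phi; apply: eq_integral => t.
  rewrite inE/= in_itv/= andbT => t_ge0.
  by rewrite ger0_norm// mulr_ge0 ?normal_pdf_ge0.
- by [].
- move=> x; apply: (@cvg_norm _ R^o); apply: cvgM => //; exact: phi_continuous.
- by move=> t /=; rewrite phiN mulNr normrN.
Qed.

Lemma lipschitz_phi_integrable h : (forall x y, `|h x - h y| <= `|x - y|) ->
  measurable_fun setT h ->
  mu.-integrable setT (EFin \o (fun t => h t * phi t)).
Proof.
move=> h_lip mh.
have dom : mu.-integrable setT (EFin \o (fun t => `|h 0| * phi t + `|t * phi t|)).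
  rewrite (_ : EFin \o _ =
    (fun t => (`|h 0|)%:E * (phi t)%:E + `|(t * phi t)%:E|)%E)//.
  apply: integrableD => //.
    by apply: integrableZl => //; exact: phi_integrable.
  by apply: integrable_abse; exact: mul_phi_integrable.
apply: le_integrable dom => //.
  apply/measurable_EFinP; apply: measurable_funM => //.
  exact: measurable_normal_pdf.
move=> t _ /=; rewrite lee_fin [leRHS]ger0_norm; last first.
  by rewrite addr_ge0// mulr_ge0 ?normal_pdf_ge0.
rewrite !normrM (ger0_norm (normal_pdf_ge0 _ _ t)) -mulrDl.
rewrite ler_wpM2r ?normal_pdf_ge0//.
have := h_lip t 0; rewrite subr0; have := ler_normD (h t - h 0) (h 0).
by rewrite subrK; lra.
Qed.

Lemma Rintegral_split_at g x : mu.-integrable setT (EFin \o g) ->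
  \int[mu]_t g t = \int[mu]_(t in `]-oo, x]) g t + \int[mu]_(t in `]x, +oo[) g t.
Proof.
move=> ig; rewrite -(@Rintegral_itvB _ g -oo%O +oo%O x).
- by rewrite set_itvNyy addrC subrK.
- by rewrite set_itvNyy.
- by [].
- by [].
Qed.

Lemma is_derive_integral_Ny g x :
  mu.-integrable setT (EFin \o g) -> continuous g ->
  is_derive x (1 : R) (fun y => \int[mu]_(t in `]-oo, y]) g t) (g x).
Proof.
move=> ig cg.
have x_lt : x < x + 1 by rewrite ltrDl.
have ig1 : mu.-integrable `]-oo, (x + 1)%R] (EFin \o g) by exact: integrableS ig.
have [] := continuous_FTC1 x_lt ig1 (ltNyr _) (cg x).
by move=> dG G'; split; [exact: dG|rewrite -derive1E; exact: G'].
Qed.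

(** Both sides have the same derivative, so it is enough to compare them at 0,
    where the left side is a half-line integral reflected. *)
Lemma Rintegral_Ny_mul_phi x :
  \int[mu]_(t in `]-oo, x]) (t * phi t) = - phi x.
Proof.
have cid_phi : continuous (fun t => t * phi t).
  by move=> t; apply: cvgM => //; exact: phi_continuous.
have dA y : is_derive y (1 : R)
    (fun y => \int[mu]_(t in `]-oo, y]) (t * phi t) + phi y) 0.
  have ? := is_derive_integral_Ny y mul_phi_integrable cid_phi.
  have ? := is_derive_phi y.
  by apply: is_derive_eq; rewrite subrr.
apply/eqP; rewrite -subr_eq0 opprK; apply/eqP.
rewrite (is_derive_0_is_cst x 0 dA).
rewrite (_ : Rintegral _ _ _ = - phi 0) ?addNr//.
rewrite /Rintegral [X in fine X](_ : _ =
    - (\int[mu]_(t in `]-oo, (- 0)%R]) (- t * phi t)%:E))%E; last first.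
  rewrite -integralN/=.
    by rewrite oppr0; apply: eq_integral => t _; rewrite mulNr opprK.
  rewrite oppr0; apply: integrable_add_def => //.
  rewrite [X in integrable _ _ X](_ : _ = -%E \o (EFin \o (fun t => t * phi t))).
    by apply: integrableN; exact: integrableS mul_phi_integrable.
  by apply/funext => t; rewrite /= mulNr EFinN.
rewrite ge0_integration_by_substitutionNy.
- rewrite [X in (- X)%E](_ : _ = (phi 0)%:E)//.
  rewrite -integral_halfline_phi; apply: eq_integral => t _ /=.
  by rewrite opprK phiN.
- apply: continuous_subspaceT => t; apply: cvgM; last exact: phi_continuous.
  exact: cvgN.
- move=> t; rewrite in_itv/= oppr0 => t_lt0.
  by rewrite mulr_ge0 ?normal_pdf_ge0// oppr_ge0 ltW.
Qed.

Lemma Rintegral_mul_phi : \int[mu]_t (t * phi t) = 0.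
Proof.
rewrite (Rintegral_split_at 0 mul_phi_integrable) Rintegral_Ny_mul_phi.
rewrite Rintegral_itv_obnd_cbnd; last exact: integrableS mul_phi_integrable.
by rewrite /Rintegral integral_halfline_phi addNr.
Qed.

Lemma centered_mul_phi_integrable u c :
  mu.-integrable setT (EFin \o (fun t => u t * phi t)) ->
  mu.-integrable setT (EFin \o (fun t => (u t - c) * phi t)).
Proof.
move=> iu.
rewrite (_ : EFin \o _ = (fun t => (u t * phi t)%:E - c%:E * (phi t)%:E)%E).
  apply: integrableB => //; apply: integrableZl => //.
  exact: phi_integrable.
by apply/funext => t; rewrite /= mulrBl.
Qed.

Lemma Rintegral_centered_mul_phi u :
  mu.-integrable setT (EFin \o (fun t => u t * phi t)) ->
  \int[mu]_t ((u t - \int[mu]_s (u s * phi s)) * phi t) = 0.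
Proof.
move=> iu; set c := \int[mu]_s (u s * phi s).
transitivity (\int[mu]_t (u t * phi t - c * phi t)).
  by apply: eq_Rintegral => t _; rewrite mulrBl.
rewrite RintegralB//.
  rewrite RintegralZl//; last exact: phi_integrable.
  by rewrite phi_mass mulr1 subrr.
rewrite (_ : EFin \o _ = (fun t => c%:E * (phi t)%:E)%E)//.
by apply: integrableZl => //; exact: phi_integrable.
Qed.

(** The integrand changes sign at most once, from negative to positive.  To the
    left of the change the claim is clear, to its right the integral over
    [`]-oo, x]] is minus the integral over [`]x, +oo[], as the total is 0. *)
Lemma Rintegral_Ny_centered_le0 u c x : {homo u : x y / x <= y} ->
  mu.-integrable setT (EFin \o (fun t => (u t - c) * phi t)) ->
  \int[mu]_t ((u t - c) * phi t) = 0 ->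
  \int[mu]_(t in `]-oo, x]) ((u t - c) * phi t) <= 0.
Proof.
move=> u_nd iu mean0; have [uxc|cux] := leP (u x) c.
  rewrite -[leRHS](_ : \int[mu]_(t in `]-oo, x]) 0 = 0); last first.
    by rewrite /Rintegral integral0.
  apply: le_Rintegral => //.
  - exact: integrableS iu.
  - exact: integrable0.
  move=> t /=; rewrite in_itv/= => tx.
  rewrite pmulr_lle0 ?phi_gt0// subr_le0.
  exact: le_trans (u_nd _ _ tx) uxc.
rewrite -[leRHS]mean0 (Rintegral_split_at x iu) lerDl.
apply: Rintegral_ge0 => t /=; rewrite in_itv/= andbT => xt.
rewrite mulr_ge0 ?normal_pdf_ge0// subr_ge0.
exact: le_trans (ltW cux) (u_nd _ _ (ltW xt)).
Qed.

Lemma lipschitz_continuous h : (forall x y, `|h x - h y| <= `|x - y|) ->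
  continuous h.
Proof.
move=> h_lip x; apply/cvgrPdist_le => e e_gt0.
near=> y; apply: (le_trans (h_lip x y)).
by near: y; apply: cvgr_dist_le.
Unshelve. all: by end_near. Qed.

(** [|Q| <= phi] holds since [Q - phi] and [- Q - phi] are the integrals over
    [`]-oo, x]] that belong to the nondecreasing functions [h + id] and
    [id - h]. *)
Theorem stein_equation_lipschitz h :
  (forall x y, `|h x - h y| <= `|x - y|) ->
  exists f df : R -> R,
    [/\ forall x, is_derive x (1 : R) f (df x),
        forall x y, `|df x - df y| <= 2 * `|x - y|
      & forall x, df x - x * f x = h x - \int[mu]_t (h t * phi t)].
Proof.
move=> h_lip; set c := \int[mu]_t (h t * phi t).
have ch := lipschitz_continuous h_lip.
have mh : measurable_fun setT h by exact: continuous_measurable_fun.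
have ih := lipschitz_phi_integrable h_lip mh.
have ihc := centered_mul_phi_integrable c ih.
pose Q x := \int[mu]_(t in `]-oo, x]) ((h t - c) * phi t).
have dQ x : is_derive x (1 : R) Q ((h x - c) * phi x).
  apply: (is_derive_integral_Ny x ihc) => t.
  apply: cvgM; last exact: phi_continuous.
  by apply: cvgB; [exact: ch|exact: cvg_cst].
have mean0 : \int[mu]_t ((h t - c) * phi t) = 0.
  exact: Rintegral_centered_mul_phi.
have itphi A : measurable A -> mu.-integrable A (EFin \o (fun t => t * phi t)).
  by move=> mA; apply: integrableS mul_phi_integrable.
have ihA A : measurable A -> mu.-integrable A (EFin \o (fun t => (h t - c) * phi t)).
  by move=> mA; apply: integrableS ihc.
have splitD A : measurable A ->
    \int[mu]_(t in A) ((h t + t - c) * phi t) =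
    \int[mu]_(t in A) ((h t - c) * phi t) + \int[mu]_(t in A) (t * phi t).
  move=> mA; rewrite -RintegralD//; [|exact: ihA|exact: itphi].
  by apply: eq_Rintegral => t _; ring.
have splitB A : measurable A ->
    \int[mu]_(t in A) ((t - h t - - c) * phi t) =
    \int[mu]_(t in A) (t * phi t) - \int[mu]_(t in A) ((h t - c) * phi t).
  move=> mA; rewrite -RintegralB//; [|exact: itphi|exact: ihA].
  by apply: eq_Rintegral => t _; ring.
have Q_le x : `|Q x| <= phi x.
  have h_incr a b : a <= b -> `|h b - h a| <= b - a.
    by move=> ab; rewrite (le_trans (h_lip _ _))// ger0_norm// subr_ge0.
  rewrite ler_norml; apply/andP; split.
  - have nd : {homo (fun t => t - h t) : a b / a <= b}.
      by move=> a b /h_incr; rewrite ler_norml; lra.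
    have iB : mu.-integrable setT (EFin \o (fun t => (t - h t - - c) * phi t)).
      rewrite (_ : EFin \o _ =
          (fun t => (t * phi t)%:E - ((h t - c) * phi t)%:E)%E).
        by apply: integrableB => //; exact: mul_phi_integrable.
      by apply/funext => t /=; rewrite -EFinB; congr EFin; ring.
    have := Rintegral_Ny_centered_le0 x nd iB.
    rewrite splitB// splitB// Rintegral_Ny_mul_phi Rintegral_mul_phi mean0 subr0.
    by move=> /(_ erefl); rewrite -/(Q x); lra.
  - have nd : {homo (fun t => h t + t) : a b / a <= b}.
      by move=> a b /h_incr; rewrite ler_norml; lra.
    have iD : mu.-integrable setT (EFin \o (fun t => (h t + t - c) * phi t)).
      rewrite (_ : EFin \o _ =
          (fun t => ((h t - c) * phi t)%:E + (t * phi t)%:E)%E).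
        by apply: integrableD => //; exact: mul_phi_integrable.
      by apply/funext => t /=; rewrite -EFinD; congr EFin; ring.
    have := Rintegral_Ny_centered_le0 x nd iD.
    rewrite splitD// splitD// Rintegral_Ny_mul_phi Rintegral_mul_phi mean0 addr0.
    by move=> /(_ erefl); rewrite -/(Q x); lra.
have [fdf df_lip] := stein_solution_regular h_lip dQ Q_le.
exists (fun x => Q x / phi x), (fun x => x * (Q x / phi x) + (h x - c)).
by split=> // x; ring.
Qed.

End GaussianIntegrals.

(** * Expectations under the normal law *)

Section NormalExpectation.
Context {R : realType}.
Local Notation mu := (@lebesgue_measure R).
Local Notation phi := (normal_pdf (0 : R) 1).

(** [phi] is almost everywhere the Radon-Nikodym derivative of the normal law,
    by uniqueness of that derivative. *)
Lemma ge0_integral_normal_prob (f : R -> \bar R) : (forall x, 0 <= f x)%E ->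
  measurable_fun setT f ->
  (\int[normal_prob (0 : R) 1]_x f x = \int[mu]_x (f x * (phi x)%:E))%E.
Proof.
move=> f0 mf.
have dom := @normal_prob_dominates R 0 1.
rewrite -(Radon_Nikodym_SigmaFinite.change_of_variables dom)//.
apply: ae_eq_integral => //.
- apply: emeasurable_funM => //.
  exact: measurable_int (Radon_Nikodym_SigmaFinite.f_integrable dom).
- apply: emeasurable_funM => //; apply/measurable_EFinP.
  exact: measurable_normal_pdf.
- apply: ae_eqe_mul2l; apply: integral_ae_eq => //.
  + exact: Radon_Nikodym_SigmaFinite.f_integrable.
  + by apply/measurable_EFinP; exact: measurable_normal_pdf.
  + by move=> A _ mA; rewrite -Radon_Nikodym_SigmaFinite.f_integral.
Qed.

(** No integrability of [h] is assumed: positive and negative parts are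
    transported separately, and both sides subtract them in the same way. *)
Lemma expectation_normal d (T : measurableType d) (Q : probability T R)
    (Z : {RV Q >-> R}) (h : R -> R) :
  (forall B : set R, measurable B -> distribution Q Z B = normal_prob 0 1 B) ->
  measurable_fun setT h ->
  ('E_Q[h \o Z] = \int[mu]_x (h x * phi x)%:E)%E.
Proof.
move=> Z_normal mh.
have ge0 (f : R -> \bar R) : (forall x, 0 <= f x)%E -> measurable_fun setT f ->
    (\int[Q]_w f (Z w) = \int[mu]_x (f x * (phi x)%:E))%E.
  move=> f0 mf; rewrite -ge0_integral_normal_prob//.
  (* The Borel sets of [R] and of [measurableTypeR R] coincide, but the two
     structures have different displays; hence the passage through [mZ]. *)
  have mZ : measurable_fun setT (Z : T -> measurableTypeR R).
    have mZ0 : measurable_fun setT Z by [].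
    by move=> mT B mB; exact: (mZ0 mT B mB).
  have := ge0_integral_pushforward mZ Q measurableT mf (fun x _ => f0 x).
  rewrite preimage_setT => <-; apply: eq_measure_integral => A mA _.
  exact: Z_normal.
have mEh : measurable_fun setT (EFin \o h) by apply/measurable_EFinP.
rewrite unlock integralE [RHS]integralE; congr (_ - _)%E.
- transitivity (\int[Q]_w (EFin \o h)^\+ (Z w))%E.
    by apply: eq_integral => w _; rewrite !funeposE.
  rewrite ge0//; last exact: measurable_funepos.
  apply: eq_integral => x _; rewrite !funeposE/= -!EFin_max -EFinM.
  by rewrite maxr_pMl ?normal_pdf_ge0// mul0r.
- transitivity (\int[Q]_w (EFin \o h)^\- (Z w))%E.
    by apply: eq_integral => w _; rewrite !funenegE.
  rewrite ge0//; last exact: measurable_funeneg.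
  apply: eq_integral => x _; rewrite !funenegE/= -!EFin_max -EFinM.
  by rewrite maxr_pMl ?normal_pdf_ge0// mul0r mulNr.
Qed.

End NormalExpectation.

(** * Centred random variables with values in {-1, 1} *)

Section FiniteExpectation.
Context d (T : measurableType d) (R : realType) (P : probability T R).

(** The events need to exhaust the space only almost surely: a variable whose
    law is concentrated on [{-1, 1}] may take other values on a null set. *)
Lemma expectation_finite_partition (S : finType) (A : S -> set T)
    (p y : S -> R) (Y : T -> R) :
  (forall s, measurable (A s)) -> trivIset setT A ->
  {ae P, forall w, exists s, A s w} ->
  (forall s, P (A s) = (p s)%:E) ->
  measurable_fun setT Y -> (forall s w, A s w -> Y w = y s) ->
  P.-integrable setT (EFin \o Y) /\ ('E_P[Y] = (\sum_s y s * p s)%:E)%E.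
Proof.
move=> mA tA covA PA mY Yy.
pose Y0 w := (\sum_s (y s)%:E * (\1_(A s) w)%:E)%E.
have iY0s s : P.-integrable setT (fun w => (y s)%:E * (\1_(A s) w)%:E)%E.
  by apply: integrableZl => //; exact: integrable_indic.
have iY0 : P.-integrable setT Y0 by apply: integrable_sum.
have YY0 : ae_eq P setT (EFin \o Y) Y0.
  apply: filterS covA => w [s Asw] _.
  rewrite /Y0 (bigD1 s)//= big1 ?adde0.
    by rewrite indicE mem_set// mule1 (Yy s).
  move=> s' s's; rewrite indicE memNset ?mule0// => As'w.
  by move/eqP: s's; apply; apply: tA => //; exists w.
have mEY : measurable_fun setT (EFin \o Y) by apply/measurable_EFinP.
have mY0 := measurable_int P iY0.
split.
  apply/integrableP; split => //.
  have /integrableP[_] := iY0; apply: le_lt_trans.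
  rewrite le_eqVlt; apply/orP; left; apply/eqP; apply: ae_eq_integral => //.
  - exact: measurableT_comp.
  - exact: measurableT_comp.
  - by apply: filterS YY0 => w /(_ I) e _; congr abse; exact: esym.
rewrite unlock (ae_eq_integral Y0)//.
rewrite integral_sum// -sumEFin; apply: eq_bigr => s _.
rewrite integralZl//; last exact: integrable_indic.
rewrite integral_indic// setIT EFinM; congr (_ * _)%E; exact: PA.
Qed.

End FiniteExpectation.

Section Rademacher.
Context d (T : measurableType d) (R : realType) (P : probability T R).

Definition rsign (b : bool) : R := if b then 1 else -1.

Lemma rsign_inj : injective rsign.
Proof.
have lt_sign : (-1 : R) < 1 by exact: lt_trans (ltrN10 R) ltr01.
by move=> [] [] //= => [/esym|] /eqP; rewrite lt_eqF.
Qed.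

Variable X : {RV P >-> R}.
Hypothesis X_support : (distribution P X [set (-1)%R; 1%R] = 1)%E.
Hypothesis X_centered : ('E_P[X] = 0)%E.

Lemma rademacher_ae : {ae P, forall w, exists b, X w = rsign b}.
Proof.
have mS : measurable (X @^-1` [set (-1)%R; 1%R]).
  rewrite -[X @^-1` _]setTI; apply: measurable_funP => //.
  exact: measurableU.
exists (~` (X @^-1` [set (-1)%R; 1%R])); split.
- exact: measurableC.
- have := X_support; rewrite /distribution/= /pushforward => XS.
  by rewrite probability_setC// XS subee.
- move=> w /= Xw [Xw1|Xw1]; apply: Xw.
    by exists false.
  by exists true.
Qed.

Let event b := X @^-1` [set rsign b].

Let mevent b : measurable (event b).
Proof. by rewrite -[event b]setTI; apply: measurable_funP. Qed.

Let tevent : trivIset setT event.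
Proof.
move=> b c _ _ [w [/= Xb Xc]]; apply: rsign_inj.
by rewrite -Xb -Xc.
Qed.

Let expectation_event (F : R -> R) : measurable_fun setT F ->
  P.-integrable setT (EFin \o (F \o X)) /\
  ('E_P[F \o X] = (\sum_b F (rsign b) * fine (P (event b)))%:E)%E.
Proof.
move=> mF; apply: (expectation_finite_partition mevent tevent).
- exact: rademacher_ae.
- by move=> b; rewrite fineK// fin_num_measure.
- exact: measurableT_comp.
- by move=> b w /= ->.
Qed.

(** The two probabilities have sum 1, and difference 0 because the mean is 0. *)
Lemma rademacher_half b : P (X @^-1` [set rsign b]) = (2^-1)%:E.
Proof.
have sum1 : fine (P (event true)) + fine (P (event false)) = 1.
  have [_] := expectation_event (measurable_cst (1 : R)).
  rewrite (_ : cst 1 \o X = cst 1)// expectation_cst big_bool/= !mul1r.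
  by move=> [].
have diff0 : fine (P (event true)) - fine (P (event false)) = 0.
  have [_] := expectation_event (@measurable_id _ _ setT).
  rewrite (_ : id \o X = X)// X_centered big_bool/= mul1r mulN1r.
  by move=> [].
rewrite -/(event b) -[LHS]fineK ?fin_num_measure//; congr EFin.
by case: b; lra.
Qed.

Lemma rademacher_expectation (F : R -> R) : measurable_fun setT F ->
  P.-integrable setT (EFin \o (F \o X)) /\
  ('E_P[F \o X] = ((F 1 + F (-1)) / 2)%:E)%E.
Proof.
move=> mF; have [iF ->] := expectation_event mF; split=> //; congr EFin.
by rewrite big_bool/= !rademacher_half/= mulrDl.
Qed.

End Rademacher.

(** * Stein's identity averaged over sign vectors *)

Section SignAverage.
Context {R : realType}.
Variables (f df : R -> R) (L : R).
Hypothesis fdf : forall x, is_derive x (1 : R) f (df x).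
Hypothesis df_lip : forall x y, `|df x - df y| <= L * `|x - y|.

(** By the mean value theorem [f y - f x] is [df z * (y - x)] for some [z]
    between [x] and [y], and [|x - z| + |y - z| = y - x]. *)
Lemma trapezoid_error (x y : R) : x <= y ->
  `|(y - x) / 2 * (df x + df y) - (f y - f x)| <= L * (y - x) ^+ 2 / 2.
Proof.
move=> xy; have [z zxy ->] := is_derive_MVT fdf xy.
have {zxy} [xz zy] : x <= z /\ z <= y by move/itvP: zxy => zxy; rewrite !zxy.
rewrite (_ : _ - _ = (y - x) / 2 * ((df x - df z) + (df y - df z))); last by field.
rewrite normrM ger0_norm ?divr_ge0 ?subr_ge0//.
rewrite (_ : L * _ / 2 = (y - x) / 2 * (L * (z - x) + L * (y - z))); last by field.
rewrite ler_wpM2l ?divr_ge0 ?subr_ge0//.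
apply: (le_trans (ler_normD _ _)); apply: lerD.
  by rewrite (le_trans (df_lip _ _))// distrC ger0_norm ?subr_ge0.
by rewrite (le_trans (df_lip _ _))// ger0_norm ?subr_ge0.
Qed.

Variable n : nat.
Hypothesis n_gt0 : (0 < n)%N.
Local Notation signs := {ffun 'I_n -> bool}.
Local Notation delta := ((Num.sqrt n%:R)^-1 : R).

(** The value of the normalised sum when the i-th summand has sign [s i]. *)
Definition sign_sum (s : signs) : R := delta * \sum_i rsign R (s i).

Let flip (i : 'I_n) (s : signs) : signs :=
  [ffun j => if j == i then ~~ s j else s j].

Let flipK i : involutive (flip i).
Proof.
by move=> s; apply/ffunP => j; rewrite !ffunE; case: eqP => // _; rewrite negbK.
Qed.

Let rsignN b : rsign R (~~ b) = - rsign R b.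
Proof. by case: b; rewrite /rsign ?opprK. Qed.

Let sign_sum_flip i s :
  sign_sum (flip i s) = sign_sum s - delta * 2 * rsign R (s i).
Proof.
rewrite /sign_sum (bigD1 i)//= [in RHS](bigD1 i)//= ffunE eqxx rsignN.
rewrite (eq_bigr (fun j => rsign R (s j))); last first.
  by move=> j /negbTE ji; rewrite ffunE ji.
ring.
Qed.

Let delta_gt0 : 0 < delta.
Proof. by rewrite invr_gt0 sqrtr_gt0 ltr0n. Qed.

Let delta_sqr : n%:R * delta ^+ 2 = 1.
Proof. by rewrite exprVn sqr_sqrtr// divff// pnatr_eq0 -lt0n. Qed.

(** The share of the i-th summand in [df W - W * f W]. *)
Let g i s := delta * (delta * df (sign_sum s) - rsign R (s i) * f (sign_sum s)).

(** The trapezoid rule between the two values of the sum that differ in the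
    sign of the i-th summand. *)
Let g_flip i s : `|g i s + g i (flip i s)| <= 2 * L * delta ^+ 3.
Proof.
have key (a : R) : `|delta * (df a + df (a + delta * 2)) -
    (f (a + delta * 2) - f a)| <= 2 * L * delta ^+ 2.
  have /trapezoid_error : a <= a + delta * 2 by rewrite lerDl mulr_ge0// ltW.
  by congr (`|_| <= _); field; rewrite gt_eqF// sqrtr_gt0 ltr0n.
rewrite (_ : 2 * L * delta ^+ 3 = delta * (2 * L * delta ^+ 2)); last by ring.
rewrite /g sign_sum_flip ffunE eqxx rsignN -mulrDr normrM gtr0_norm//.
rewrite ler_pM2l//; case: (s i); rewrite /rsign.
- have := key (sign_sum s - delta * 2 * 1).
  rewrite (_ : _ + delta * 2 = sign_sum s); last by ring.
  by congr (`|_| <= _); ring.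
- have := key (sign_sum s).
  rewrite (_ : sign_sum s - delta * 2 * -1 = sign_sum s + delta * 2); last by ring.
  by congr (`|_| <= _); ring.
Qed.

(** Flipping the i-th sign is an involution of the sign vectors, so the sum of
    [g i] is half the sum over all pairs bounded by [g_flip]. *)
Lemma sign_average_stein :
  `|\sum_(s : signs) (df (sign_sum s) - sign_sum s * f (sign_sum s))|
  <= #|{: signs}|%:R * (L * delta).
Proof.
have bound i : `|\sum_s g i s| <= #|{: signs}|%:R * (L * delta ^+ 3).
  have twice : (\sum_s g i s) *+ 2 = \sum_s (g i s + g i (flip i s)).
    rewrite big_split/= mulr2n; congr (_ + _).
    by rewrite (reindex_inj (can_inj (flipK i))).
  rewrite -(ler_pMn2r (n := 2))// -normrMn twice.
  apply: (le_trans (ler_norm_sum _ _ _)).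
  apply: (@le_trans _ _ (\sum_(s : signs) 2 * L * delta ^+ 3)).
    by apply: ler_sum => s _; exact: g_flip.
  rewrite sumr_const -[leLHS]mulr_natl -[leRHS]mulr_natl le_eqVlt.
  by apply/orP; left; apply/eqP; ring.
rewrite (eq_bigr (fun s => \sum_i g i s)); last first.
  move=> s _.
  have -> : \sum_i g i s = delta * (n%:R * (delta * df (sign_sum s)) -
      (\sum_i rsign R (s i)) * f (sign_sum s)).
    by rewrite -mulr_sumr sumrB sumr_const card_ord mulr_natl mulr_suml.
  rewrite mulrBr; congr (_ - _); last by rewrite mulrA.
  rewrite [RHS](_ : _ = n%:R * delta ^+ 2 * df (sign_sum s)); last by ring.
  by rewrite delta_sqr mul1r.
rewrite exchange_big/=; apply: (le_trans (ler_norm_sum _ _ _)).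
apply: (@le_trans _ _ (\sum_(i < n) #|{: signs}|%:R * (L * delta ^+ 3))).
  by apply: ler_sum => i _; exact: bound.
rewrite sumr_const card_ord -[leLHS]mulr_natl le_eqVlt; apply/orP; left; apply/eqP.
rewrite [LHS](_ : _ =
  (n%:R * delta ^+ 2) * (#|{: signs}|%:R * (L * delta))); last by ring.
by rewrite delta_sqr mul1r.
Qed.

End SignAverage.

(** * The normalised sum and the Stein kernel *)

Section RademacherSum.
Context d (T : measurableType d) (R : realType) (P : probability T R).
Variables (n : nat) (xi : 'I_n -> {RV P >-> R}).
Hypothesis xi_indep : independent_RVs P xi.
Hypothesis xi_centered : forall i, ('E_P[xi i] = 0)%E.
Hypothesis xi_support :
  forall i, (distribution P (xi i) [set (-1)%R; 1%R] = 1)%E.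

Lemma rademacher_sum_expectation (F : R -> R) : measurable_fun setT F ->
  ('E_P[fun w => F ((Num.sqrt n%:R)^-1 * \sum_(i < n) xi i w)%R] =
   (\sum_(s : {ffun 'I_n -> bool}) F (sign_sum s) * 2^-1 ^+ n)%:E)%E.
Proof.
move=> mF.
pose A (s : {ffun 'I_n -> bool}) :=
  \bigcap_(i in [set` [set: 'I_n]%SET]) (xi i @^-1` [set rsign R (s i)]).
have AE s w : A s w -> forall i, xi i w = rsign R (s i).
  by move=> Asw i; apply: Asw => /=; rewrite inE.
apply: (proj2 (expectation_finite_partition (A := A)
  (p := fun=> 2^-1 ^+ n) (y := fun s => F (sign_sum s)) _ _ _ _ _ _)).
- by move=> s; exact: fin_bigcap_measurable.
- move=> s s' _ _ [w [/AE sw /AE s'w]]; apply/ffunP => i.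
  by apply: (@rsign_inj R); rewrite -sw -s'w.
- have /filter_forall : forall i, {ae P, forall w, exists b, xi i w = rsign R b}.
    by move=> i; exact: rademacher_ae.
  apply: filterS => w /choice[s sP].
  by exists [ffun i => s i] => i _; rewrite /= ffunE sP.
- move=> s; rewrite /A xi_indep; last by move=> i _; exact: measurable_set1.
  rewrite (eq_bigr (fun=> (2^-1 : R)%:E)); last first.
    by move=> i _; exact: rademacher_half.
  by rewrite prodEFin prodr_const cardsT card_ord.
- apply: measurableT_comp => //; apply: measurable_funM => //.
  exact: measurable_sum.
- move=> s w /AE sw; rewrite /sign_sum; congr (F (_ * _)).
  by apply: eq_bigr => i _; rewrite sw.
Qed.

End RademacherSum.

Section SteinKernel.
Context {R : realType}.

Lemma measurable_lattice_fun (g : R -> R) : lattice_fun g -> measurable_fun setT g.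
Proof.
move=> [g0 ->] _ B mB; rewrite setTI.
rewrite (_ : _ @^-1` _ = \bigcup_(k : int)
    (if g0 k \in B then [set` `[k%:~R : R, (k + 1)%:~R[%R] else set0)).
  apply: countable_bigcupT_measurable => // k.
  by case: ifP => // _; exact: measurable_itv.
apply/seteqP; split => x /=.
  move=> Bx; exists (Num.floor x) => //.
  by rewrite mem_set//= in_itv/=; exact: floor_itv.
move=> [k _]; case: ifPn => [/set_mem Bk|//].
by rewrite /= in_itv/= -floor_eq => /eqP ->.
Qed.

(** Both expectations are [(g 1 - g (-1)) / 2]. *)
Lemma rademacher_stein_kernel d (T : measurableType d) (P : probability T R)
    (X : {RV P >-> R}) :
  ('E_P[X] = 0)%E -> (distribution P X [set (-1)%R; 1%R] = 1)%E ->
  stein_kernel P (@central_diff R) 1 (@lattice_fun R) X 0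
    (fun w => \1_[set (1 : R)] (X w)).
Proof.
move=> X_centered X_support; split => //.
  move=> _ [B mB <-]; exists (\1_[set (1 : R)] @^-1` B); last by [].
  rewrite -[_ @^-1` _]setTI; apply: (@measurable_indic _ _ R setT) => //.
move=> g /measurable_lattice_fun mg.
have m1 : measurable_fun setT
    (fun x : R => \1_[set (1 : R)] x * central_diff g (x - 1)).
  apply: measurable_funM; first exact: measurable_indic.
  apply: measurable_funB; apply: measurableT_comp => //.
    by apply: measurable_funD => //; exact: measurable_funB.
  by apply: measurable_funB => //; exact: measurable_funB.
have m2 : measurable_fun setT (fun x : R => (x - 0) * g x).
  by apply: measurable_funM => //; exact: measurable_funB.
have [i1 E1] := rademacher_expectation X_support X_centered m1.
have [i2 E2] := rademacher_expectation X_support X_centered m2.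
split=> //; rewrite [LHS]E1 [RHS]E2; congr EFin.
have -> : \1_[set (1 : R)] (1 : R) = 1 :> R by rewrite indicE mem_set.
have -> : \1_[set (1 : R)] (-1 : R) = 0 :> R.
  by rewrite indicE memNset//= => /eqP; rewrite lt_eqF// (lt_trans (ltrN10 R)).
by rewrite /central_diff !(subrr, sub0r, add0r); ring.
Qed.

End SteinKernel.

Theorem corollary57 (R : realType)
    (d : measure_display) (T : measurableType d) (P : probability T R)
    (d' : measure_display) (T' : measurableType d') (Q : probability T' R)
    (n : nat) (n_gt0 : (0 < n)%N)
    (xi : 'I_n -> {RV P >-> R})
    (xi_indep : independent_RVs P xi)
    (xi_centered : forall i, ('E_P[xi i] = 0)%E)
    (xi_support : forall i, (distribution P (xi i) [set (-1)%R; 1%R] = 1)%E)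
    (Z : {RV Q >-> R})
    (Z_normal : forall B : set R, measurable B ->
                  distribution Q Z B = normal_prob 0 1 B) :
  (forall i, stein_kernel P (@central_diff R) 1 (@lattice_fun R) (xi i) 0
               (fun w => \1_[set (1 : R)] (xi i w))) /\
  (dWass P Q (fun w => ((Num.sqrt n%:R)^-1 * \sum_(i < n) xi i w)%R) Z
     <= (3 / Num.sqrt n%:R)%:E)%E.
Proof.
split=> [i|]; first exact: rademacher_stein_kernel.
apply: ge_ereal_sup => _ [h /= h_lip1 <-].
have h_lip x y : `|h x - h y| <= `|x - y|.
  by have := h_lip1 (x, y); rewrite /= mul1r; apply.
have mh : measurable_fun setT h.
  by apply: continuous_measurable_fun; exact: lipschitz_continuous.
have [f [df [fdf df_lip steinE]]] := stein_equation_lipschitz h_lip.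
rewrite (rademacher_sum_expectation xi_indep xi_centered xi_support mh).
rewrite (expectation_normal Z_normal mh).
rewrite -[X in (_ - X)%E]fineK; last first.
  by apply: integrable_fin_num => //; exact: lipschitz_phi_integrable.
rewrite -EFinB/= lee_fin.
set c := fine _.
pose N : R := #|{: {ffun 'I_n -> bool}}|%:R.
have NE : N * 2^-1 ^+ n = 1.
  by rewrite /N card_ffun card_bool card_ord natrX -exprMn divff ?expr1n.
have sumE : \sum_(s : {ffun 'I_n -> bool})
    (df (sign_sum s) - sign_sum s * f (sign_sum s)) =
    (\sum_(s : {ffun 'I_n -> bool}) h (sign_sum s)) - N * c.
  rewrite (eq_bigr (fun s => h (sign_sum s) - c)); last first.
    by move=> s _; rewrite steinE.
  by rewrite sumrB sumr_const -[c *+ _]mulr_natl.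
have cE : c = N * c * 2^-1 ^+ n by rewrite mulrAC NE mul1r.
rewrite -mulr_suml [X in _ - X]cE -mulrBl -sumE.
rewrite normrM [X in _ * X]ger0_norm ?exprn_ge0 ?invr_ge0//.
apply: (@le_trans _ _ (N * (2 / Num.sqrt n%:R) * 2^-1 ^+ n)).
  rewrite ler_wpM2r ?exprn_ge0 ?invr_ge0//.
  exact: sign_average_stein.
by rewrite mulrAC NE mul1r ler_wpM2r ?invr_ge0 ?sqrtr_ge0// ler_nat.
Qed.
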